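(* Let $-1\le\alpha\le1$ and $\beta>1$, and suppose $f(\phi)=(\cos\phi+\alpha)^2(\cos\phi+\beta)\in C_3^0$. Let $\bar f(\phi)=(\cos\phi+\alpha)^2(\cos\phi+1)$. Then $\bar f\in C_3^0$ and $v(f)>v(\bar f)$.
   Context: Every cosine polynomial $f$ of degree $n$ can be written as $f(\phi)=h(\cos\phi)$ for a unique real algebraic polynomial $h$; a double root of $f$ means a point $x_0\in[-1,1]$ that is a zero of $h$ of multiplicity at least $2$. $C_n^0$ denotes the set of degree-$n$ cosine polynomials $f(\phi)=a_0+a_1\cos\phi+\dots+a_n\cos n\phi$ with real coefficients such that: (B.1) $f$ is nonnegative on $\mathbb{R}$ and has a double root; (B.2) all coefficients are nonnegative; (B.3) $a_1>a_0>0$. For such $f$, $v(f)=\dfrac{f(0)-a_0}{(\sqrt{a_1}-\sqrt{a_0})^2}$. *)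

(* Defs.v *)
From mathcomp Require Import all_boot all_order all_algebra.
From mathcomp Require Import ring.
From mathcomp Require Import boolp classical_sets reals exp trigo.

Set Implicit Arguments.
Unset Strict Implicit.
Unset Printing Implicit Defensive.

Import Order.TTheory GRing.Theory Num.Theory.
Local Open Scope classical_set_scope.
Local Open Scope ring_scope.

(* Here a : {poly R} is only a finitely supported coefficient sequence: its
   entry a`_k multiplies cos (k phi), not a power of cos phi. *)
Definition cosine_sum (R : realType) (a : {poly R}) (phi : R) : R :=
  \sum_(k < size a) a`_k * cos (phi *+ k).

(* The sequence (a_0, a_1, ...) with f(phi) = \sum_k a_k cos (k phi); it is
   unique (cosine_coefE below), and by convention 0 if f is not a cosine
   polynomial. *)
Definition cosine_coef (R : realType) (f : R -> R) : {poly R} :=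
  xget 0 [set a | f =1 cosine_sum a].

Definition cosine_poly (R : realType) (n : nat) (f : R -> R) : Prop :=
  exists a : {poly R}, size a = n.+1 /\ f =1 cosine_sum a.

(* The polynomial h is unique, by horner_cos_eq0 below. *)
Definition has_double_root (R : realType) (f : R -> R) : Prop :=
  exists h : {poly R}, (forall phi, f phi = h.[cos phi]) /\
  exists x0 : R, -1 <= x0 <= 1 /\ (2 <= mup x0 h)%N.

Definition C0 (R : realType) (n : nat) (f : R -> R) : Prop :=
  [/\ cosine_poly n f,
      (forall phi, 0 <= f phi) /\ has_double_root f,
      (forall k : nat, 0 <= (cosine_coef f)`_k) &
      (cosine_coef f)`_1 > (cosine_coef f)`_0 /\ (cosine_coef f)`_0 > 0].

Definition v (R : realType) (f : R -> R) : R :=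
  (f 0 - (cosine_coef f)`_0) /
  (Num.sqrt (cosine_coef f)`_1 - Num.sqrt (cosine_coef f)`_0) ^+ 2.

Lemma cosine_sum_widen (R : realType) (a : {poly R}) (N : nat) (phi : R) :
  (size a <= N)%N -> cosine_sum a phi = \sum_(k < N) a`_k * cos (phi *+ k).
Proof.
move=> aN; rewrite /cosine_sum (big_ord_widen N (fun k => a`_k * cos (phi *+ k)))//.
rewrite [RHS](bigID (fun k : 'I_N => (k < size a)%N))/= [X in _ = _ + X]big1 ?addr0//.
by move=> k; rewrite -leqNgt => ak; rewrite nth_default// mul0r.
Qed.

Lemma chebyshev_exists (R : realType) (n : nat) : exists T : {poly R},
  size T = n.+1 /\ forall phi, cos (phi *+ n) = T.[cos phi].
Proof.
suff [T [U [? ? _ _]]] : exists T U : {poly R},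
    [/\ size T = n.+1, forall phi, cos (phi *+ n) = T.[cos phi],
     size U = n.+2 & forall phi, cos (phi *+ n.+1) = U.[cos phi]] by exists T.
elim: n => [|n [T [U [sT hT sU hU]]]].
  exists 1, 'X; split; rewrite ?size_poly1 ?size_polyX// => phi.
    by rewrite mulr0n cos0 hornerC.
  by rewrite mulr1n hornerX.
exists U, (2%:P * ('X * U) - T); split => // [|phi].
  have two0 : (2 : R) != 0 by rewrite pnatr_eq0.
  have U0 : U != 0 by rewrite -size_poly_eq0 sU.
  have sXU : size (2%:P * ('X * U)) = n.+3.
    by rewrite mul_polyC size_scale// mulrC size_mulX// sU.
  by rewrite size_polyDl sXU// size_polyN sT ltnS leqW.
have -> : phi *+ n.+2 = phi *+ n.+1 + phi by rewrite mulrSr.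
rewrite hornerD hornerN !hornerM hornerC hornerX -hU -hT.
have -> : phi *+ n = phi *+ n.+1 - phi by rewrite mulrSr addrK.
rewrite cosD cosB; ring.
Qed.

Lemma cosine_sum_horner (R : realType) (a : {poly R}) : exists h : {poly R},
  size h = size a /\ forall phi, cosine_sum a phi = h.[cos phi].
Proof.
have [T hT] := choice (chebyshev_exists R).
exists (\sum_(k < size a) a`_k *: T k); split; last first.
  move=> phi; rewrite horner_sum; apply: eq_bigr => k _.
  by rewrite hornerZ (hT k).2.
case sa : (size a) => [|n]; first by rewrite big_ord0 size_poly0.
have an0 : a`_n != 0.
  have : a != 0 by rewrite -size_poly_eq0 sa.
  by rewrite -lead_coef_eq0 lead_coefE sa.
rewrite big_ord_recr/= addrC size_polyDl size_scale// (hT n).1// ltnS.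
apply: (leq_trans (size_sum _ _ _)); apply/bigmax_leqP => k _.
by apply: (leq_trans (size_scale_leq _ _)); rewrite (hT k).1.
Qed.

Lemma horner_cos_eq0 (R : realType) (h : {poly R}) :
  (forall phi, h.[cos phi] = 0) -> h = 0.
Proof.
move=> h0; pose x (k : nat) : R := k.+1%:R^-1.
apply: (@roots_geq_poly_eq0 _ _ [seq x k | k <- iota 0 (size h)]).
- apply/allP => _ /mapP[k _ ->]; rewrite rootE -[x k]acosK ?h0//.
  rewrite in_itv/=; apply/andP; split.
    by rewrite (le_trans (lerN10 _))// invr_ge0.
  by rewrite invf_le1 ?ltr0n// ler1n.
- rewrite map_inj_uniq ?iota_uniq// => i j /invr_inj/eqP.
  by rewrite eqr_nat => /eqP[].
- by rewrite size_map size_iota.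
Qed.

Lemma cosine_sum_inj (R : realType) (a b : {poly R}) :
  cosine_sum a =1 cosine_sum b -> a = b.
Proof.
move=> ab; apply/eqP; rewrite -subr_eq0 -size_poly_eq0.
have [h [<- hE]] := cosine_sum_horner (a - b).
rewrite size_poly_eq0; apply/eqP/horner_cos_eq0 => phi; rewrite -hE.
pose N := maxn (size (a - b)) (maxn (size a) (size b)).
rewrite (@cosine_sum_widen _ _ N) ?leq_maxl//.
under eq_bigr do rewrite coefB mulrBl.
rewrite big_split/= sumrN.
by rewrite -!cosine_sum_widen ?ab ?subrr// /N !leq_max !leqnn !orbT.
Qed.

Lemma cosine_coefE (R : realType) (f : R -> R) (a : {poly R}) :
  f =1 cosine_sum a -> cosine_coef f = a.
Proof.
move=> fa; apply: xget_unique => // b fb.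
by apply: cosine_sum_inj => phi; rewrite -fa -fb.
Qed.

(* Main.v *)
(* Write [f = fbar + (beta - 1) g] with [g phi = (cos phi + alpha)^2], and let
   [(a0, a1)], [(b0, b1)], [(c0, c1)] be the first two cosine coefficients of
   [f], [fbar], [g]. The hypothesis [a1 > a0] forces [alpha > - 1/4], so the
   numerator of [v] increases with [beta], and when [c1 <= c0] it suffices that
   the gap [sqrt a1 - sqrt a0] decreases with [beta]. When [c1 > c0],
   Cauchy-Schwarz makes
   [(a0, a1) |-> (sqrt a1 - sqrt a0)^2] subadditive, so [1 / v f] is at most the
   mediant of [1 / v fbar] and [1 / v g], and [v g > v fbar] reduces to a
   polynomial inequality in [alpha] on [[0, 1]]. *)
Require Import Defs.
From mathcomp Require Import all_boot all_order all_algebra.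
From mathcomp Require Import ring lra.
From mathcomp Require Import boolp classical_sets reals exp trigo.
Import Order.TTheory GRing.Theory Num.Theory.
Local Open Scope ring_scope.

(** Once the squares are expanded, this is Cauchy-Schwarz for the vectors (sqrt x0, sqrt y0) and
    (sqrt x1, sqrt y1). *)
Lemma sqrtB_sqr_subadd (R : rcfType) (x0 x1 y0 y1 : R) :
  0 <= x0 -> 0 <= x1 -> 0 <= y0 -> 0 <= y1 ->
  (Num.sqrt (x1 + y1) - Num.sqrt (x0 + y0)) ^+ 2 <=
  (Num.sqrt x1 - Num.sqrt x0) ^+ 2 + (Num.sqrt y1 - Num.sqrt y0) ^+ 2.
Proof.
move=> x0_ge0 x1_ge0 y0_ge0 y1_ge0.
have cs : Num.sqrt x0 * Num.sqrt x1 + Num.sqrt y0 * Num.sqrt y1 <=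
    Num.sqrt (x0 + y0) * Num.sqrt (x1 + y1).
  rewrite -(@ler_pXn2r _ 2) ?nnegrE ?addr_ge0 ?mulr_ge0 ?sqrtr_ge0//.
  rewrite exprMn !sqr_sqrtr ?addr_ge0//.
  rewrite -{2}[x0]sqr_sqrtr// -{2}[x1]sqr_sqrtr//.
  rewrite -{2}[y0]sqr_sqrtr// -{2}[y1]sqr_sqrtr//.
  have := sqr_ge0 (Num.sqrt x0 * Num.sqrt y1 - Num.sqrt y0 * Num.sqrt x1).
  lra.
rewrite !sqrrB !sqr_sqrtr ?addr_ge0//.
lra.
Qed.

Lemma sqrtB_factor (R : rcfType) (x y : R) : 0 <= x -> 0 <= y ->
  (Num.sqrt y - Num.sqrt x) * (Num.sqrt y + Num.sqrt x) = y - x.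
Proof. by move=> x0 y0; rewrite -subr_sqr !sqr_sqrtr. Qed.

(** Follows from (sqrt y + sqrt x)^2 <= 2 (x + y); bounds a squared gap below without square
    roots. *)
Lemma sqrtB_sqr_ge (R : rcfType) (x y : R) : 0 <= x -> 0 <= y ->
  (y - x) ^+ 2 <= (Num.sqrt y - Num.sqrt x) ^+ 2 * (2 * (x + y)).
Proof.
move=> x0 y0; rewrite -(sqrtB_factor _ _ _ x0 y0) exprMn ler_wpM2l ?sqr_ge0//.
have := sqr_ge0 (Num.sqrt y - Num.sqrt x).
rewrite sqrrB sqrrD !sqr_sqrtr//; lra.
Qed.

(** Follows from sqrt y + sqrt x >= 2 sqrt x; the companion upper bound. *)
Lemma sqrtB_sqr_le (R : rcfType) (x y : R) : 0 <= x -> x <= y ->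
  (Num.sqrt y - Num.sqrt x) ^+ 2 * (4 * x) <= (y - x) ^+ 2.
Proof.
move=> x0 xy; have y0 := le_trans x0 xy.
rewrite -(sqrtB_factor _ _ _ x0 y0) exprMn ler_wpM2l ?sqr_ge0//.
have sxy : Num.sqrt x <= Num.sqrt y by rewrite ler_sqrt.
have -> : 4 * x = (2 * Num.sqrt x) ^+ 2 by rewrite exprMn sqr_sqrtr//; ring.
by rewrite ler_pXn2r ?nnegrE ?addr_ge0 ?mulr_ge0 ?sqrtr_ge0//; lra.
Qed.

(* [(a + 1/8) / 2] is the tangent at [a = 3/4] of the concave
   [2 a - (a ^+ 2 + 1 / 2)], which it replaces in [tangent_ineq]. *)
Lemma tangent_bound (R : realFieldType) (a : R) :
  2 * a - (a ^+ 2 + 1 / 2) <= (a + 1 / 8) / 2.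
Proof. have := sqr_ge0 (a - 3 / 4); rewrite sqrrB; lra. Qed.

(** The form that [v_quadratic_gt] takes once its square roots have been bounded away. *)
Lemma tangent_ineq (R : realFieldType) (a : R) : 0 <= a <= 1 ->
  (a ^+ 2 + 3 * a + 3 / 2) * (2 * a ^+ 2 + 3 * a + 5 / 4) * (a + 1 / 8) ^+ 2 <
  16 * (a + 1 / 4) ^+ 3 * (a ^+ 2 + 1 / 2).
Proof.
move=> /andP[a0 a1]; pose b := 1 - a.
have b0 : 0 <= b by rewrite subr_ge0.
rewrite -subr_gt0.
(* the expansion in the Bernstein basis of degree 6 *)
have -> : 16 * (a + 1 / 4) ^+ 3 * (a ^+ 2 + 1 / 2) -
    (a ^+ 2 + 3 * a + 3 / 2) * (2 * a ^+ 2 + 3 * a + 5 / 4) * (a + 1 / 8) ^+ 2 =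
  (49 * b ^+ 6 + 756 * (a * b ^+ 5) + 4123 * (a ^+ 2 * b ^+ 4) +
   9552 * (a ^+ 3 * b ^+ 3) + 8935 * (a ^+ 4 * b ^+ 2) +
   5548 * (a ^+ 5 * b) + 1725 * a ^+ 6) / 512.
  by rewrite /b; field.
have p k l : 0 <= a ^+ k * b ^+ l by rewrite mulr_ge0 ?exprn_ge0.
have := p 0%N 6; have := p 1%N 5; have := p 2 4; have := p 3 3.
have := p 4 2; have := p 5 1%N; have := p 6 0%N.
rewrite !expr0 !expr1 !mul1r !mulr1 => p6 p5 p4 p3 p2 p1 p0.
(* Strictness needs one positive term: [b ^+ 6] away from [a = 1], [a ^+ 6] away from [a = 0]. *)
have [a_small|a_big] := ltP a (1 / 2).
  have b6 : 0 < b ^+ 6 by rewrite exprn_gt0// /b; lra.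
  lra.
have a6 : 0 < a ^+ 6 by rewrite exprn_gt0//; lra.
lra.
Qed.

(** Coefficients of (cos phi + alpha)^2 (cos phi + beta) in the basis cos (k phi), not in powers of
    cos phi. *)
Definition cubic_coef {R : realType} (alpha beta : R) : {poly R} :=
  Poly [:: alpha ^+ 2 * beta + alpha + beta / 2;
           alpha ^+ 2 + 2 * alpha * beta + 3 / 4; alpha + beta / 2; 1 / 4].

Lemma polyseq_cubic_coef (R : realType) (alpha beta : R) :
  cubic_coef alpha beta =
  [:: alpha ^+ 2 * beta + alpha + beta / 2;
      alpha ^+ 2 + 2 * alpha * beta + 3 / 4; alpha + beta / 2; 1 / 4] :> seq R.
Proof. by rewrite (PolyK (c := 1))//= mul1r invr_eq0 pnatr_eq0. Qed.

Lemma cubic_cosine_sum (R : realType) (alpha beta : R) :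
  (fun phi => (cos phi + alpha) ^+ 2 * (cos phi + beta)) =1
  cosine_sum (cubic_coef alpha beta).
Proof.
move=> phi; rewrite /cosine_sum polyseq_cubic_coef/= !big_ord_recr big_ord0/=.
rewrite mulr0n mulr1n cos0 [phi *+ 3]mulrS mulr2n !cosD sinD.
have -> : sin phi * (sin phi * cos phi + cos phi * sin phi) =
    2 * cos phi * sin phi ^+ 2 by ring.
have -> : cos phi * cos phi - sin phi * sin phi = 2 * cos phi ^+ 2 - 1.
  by rewrite -[sin phi * _]expr2 sin2cos2; ring.
by rewrite sin2cos2; field.
Qed.

Lemma cubic_cosine_coef (R : realType) (alpha beta : R) :
  cosine_coef (fun phi => (cos phi + alpha) ^+ 2 * (cos phi + beta)) =
  cubic_coef alpha beta.
Proof. exact: cosine_coefE (cubic_cosine_sum _ _ _). Qed.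

Lemma v_cubic (R : realType) (alpha beta : R) :
  v (fun phi => (cos phi + alpha) ^+ 2 * (cos phi + beta)) =
  (alpha ^+ 2 + alpha + 1 + (2 * alpha + 1 / 2) * beta) /
  (Num.sqrt (alpha ^+ 2 + 2 * alpha * beta + 3 / 4) -
   Num.sqrt (alpha ^+ 2 * beta + alpha + beta / 2)) ^+ 2.
Proof.
by rewrite /v cubic_cosine_coef polyseq_cubic_coef/= cos0; congr (_ / _); field.
Qed.

(** Here a1 - a0 = alpha + 1/4, whence the lower bound on [alpha]; the upper one keeps the double
    root [- alpha] in [-1, 1]. *)
Lemma C0_cubic1 (R : realType) (alpha : R) : - (1 / 4) < alpha <= 1 ->
  C0 3 (fun phi : R => (cos phi + alpha) ^+ 2 * (cos phi + 1)).
Proof.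
move=> /andP[alpha_gt alpha_le1].
have sq_alpha := sqr_ge0 alpha.
have a0_gt0 : 0 < alpha ^+ 2 * 1 + alpha + 1 / 2.
  by have := sqr_ge0 (alpha + 1 / 2); rewrite sqrrD; lra.
have a01 : alpha ^+ 2 * 1 + alpha + 1 / 2 <
  alpha ^+ 2 + 2 * alpha * 1 + 3 / 4 by lra.
split.
- exists (cubic_coef alpha 1); split; last exact: cubic_cosine_sum.
  by rewrite polyseq_cubic_coef.
- split=> [phi|].
    by rewrite mulr_ge0 ?sqr_ge0//; have := cos_geN1 phi; lra.
  exists (('X - (- alpha)%:P) ^+ 2 * ('X - (-1)%:P)); split=> [phi|].
    by rewrite hornerM horner_exp !hornerXsubC !opprK.
  exists (- alpha); split; first by apply/andP; split; lra.
  rewrite mup_geq; first exact: dvdp_mulr.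
  by rewrite mulf_neq0 ?expf_neq0// polyXsubC_eq0.
- move=> k; rewrite cubic_cosine_coef polyseq_cubic_coef.
  by case: k => [|[|[|[|k]]]]/=; rewrite ?nth_nil//; lra.
- by rewrite cubic_cosine_coef polyseq_cubic_coef.
Qed.

(* [N], [(b0, b1)] and [Ng], [(c0, c1)] are the data of [v fbar] and [v g]. *)
Lemma v_quadratic_gt (R : rcfType) (alpha : R) :
  let b0 := alpha ^+ 2 + alpha + 1 / 2 in
  let b1 := alpha ^+ 2 + 2 * alpha + 3 / 4 in
  let c0 := alpha ^+ 2 + 1 / 2 in
  let c1 := 2 * alpha in
  let N := alpha ^+ 2 + 3 * alpha + 3 / 2 in
  let Ng := 2 * alpha + 1 / 2 in
  0 <= alpha <= 1 -> c0 < c1 ->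
  N * (Num.sqrt c1 - Num.sqrt c0) ^+ 2 < Ng * (Num.sqrt b1 - Num.sqrt b0) ^+ 2.
Proof.
move=> b0 b1 c0 c1 N Ng alpha01 c01.
have /andP[alpha0 alpha1] := alpha01.
have sq_alpha := sqr_ge0 alpha.
have b0_gt0 : 0 < b0 by rewrite /b0; lra.
have b1_gt0 : 0 < b1 by rewrite /b1; lra.
have c0_gt0 : 0 < c0 by rewrite /c0; lra.
have N_gt0 : 0 < N by rewrite /N; lra.
have Ng_gt0 : 0 < Ng by rewrite /Ng; lra.
have Wb := sqrtB_sqr_ge _ _ _ (ltW b0_gt0) (ltW b1_gt0).
have Wc := sqrtB_sqr_le _ _ _ (ltW c0_gt0) (ltW c01).
set wb := (Num.sqrt b1 - _) ^+ 2 in Wb *.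
set wc := (Num.sqrt c1 - _) ^+ 2 in Wc *.
have d2 : (c1 - c0) ^+ 2 <= ((alpha + 1 / 8) / 2) ^+ 2.
  rewrite ler_pXn2r ?nnegrE ?tangent_bound//; last by lra.
  by rewrite subr_ge0 ltW.
have S_gt0 : 0 < 2 * (b0 + b1) by lra.
have T_gt0 : 0 < 4 * c0 by lra.
(* Multiplying by the factors occurring in [Wb] and [Wc] lets these bounds eliminate [wb] and
   [wc]. *)
rewrite -(ltr_pM2r S_gt0) -(ltr_pM2r T_gt0).
have lhs : N * wc * (2 * (b0 + b1)) * (4 * c0) <=
    N * (2 * (b0 + b1)) * ((alpha + 1 / 8) / 2) ^+ 2.
  have -> : N * wc * (2 * (b0 + b1)) * (4 * c0) =
    N * (2 * (b0 + b1)) * (wc * (4 * c0)) by ring.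
  by rewrite ler_wpM2l ?(le_trans Wc)// mulr_ge0// ltW.
have rhs : Ng * (4 * c0) * (b1 - b0) ^+ 2 <= Ng * wb * (2 * (b0 + b1)) * (4 * c0).
  have -> : Ng * wb * (2 * (b0 + b1)) * (4 * c0) =
    Ng * (4 * c0) * (wb * (2 * (b0 + b1))) by ring.
  by rewrite ler_wpM2l// mulr_ge0// ltW.
apply: le_lt_trans lhs (lt_le_trans _ rhs).
have := tangent_ineq _ _ alpha01.
have -> : N * (2 * (b0 + b1)) * ((alpha + 1 / 8) / 2) ^+ 2 =
  (alpha ^+ 2 + 3 * alpha + 3 / 2) * (2 * alpha ^+ 2 + 3 * alpha + 5 / 4) *
  (alpha + 1 / 8) ^+ 2 / 2 by rewrite /N /b0 /b1; field.
have -> : Ng * (4 * c0) * (b1 - b0) ^+ 2 =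
  16 * (alpha + 1 / 4) ^+ 3 * (alpha ^+ 2 + 1 / 2) / 2.
  by rewrite /Ng /c0 /b0 /b1; field.
lra.
Qed.

(** A gap of roots is the difference divided by the sum of the roots. If [x1 < y1], passing from x
    to y does not increase the difference and does not decrease that sum; otherwise compare
    termwise. *)
Lemma sqrtB_le_of_gap (R : rcfType) (x0 x1 y0 y1 : R) :
  0 <= x0 -> x0 < x1 -> x0 <= y0 -> y0 < y1 ->
  y1 - y0 <= x1 - x0 ->
  Num.sqrt y1 - Num.sqrt y0 <= Num.sqrt x1 - Num.sqrt x0.
Proof.
move=> x0_ge0 x01 xy0 y01 gap.
have [y0_ge0 x1_ge0] : 0 <= y0 /\ 0 <= x1 by split; lra.
have y1_ge0 : 0 <= y1 by lra.
have s0 : Num.sqrt x0 <= Num.sqrt y0 by rewrite ler_sqrt.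
have [s1|/ltW s1] := leP (Num.sqrt y1) (Num.sqrt x1); first by lra.
rewrite leNgt; apply/negP => lt_gap.
have sx01 : Num.sqrt x0 < Num.sqrt x1 by rewrite ltr_sqrt//; lra.
move: gap; rewrite -(sqrtB_factor _ _ _ x0_ge0 x1_ge0) -(sqrtB_factor _ _ _ y0_ge0 y1_ge0) leNgt => /negP; apply.
apply: (@lt_le_trans _ _ ((Num.sqrt y1 - Num.sqrt y0) * (Num.sqrt x1 + Num.sqrt x0))).
  by rewrite ltr_pM2r//; have := sqrtr_ge0 x0; lra.
by rewrite ler_wpM2l//; lra.
Qed.

Theorem theorem2p12 (R : realType) (alpha beta : R) :
  let f := fun phi : R => (cos phi + alpha) ^+ 2 * (cos phi + beta) in
  let fbar := fun phi : R => (cos phi + alpha) ^+ 2 * (cos phi + 1) in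
  -1 <= alpha <= 1 -> beta > 1 -> C0 3 f ->
  C0 3 fbar /\ v f > v fbar.
Proof.
move=> f fbar /andP[alpha_ge alpha_le] beta_gt [_ _ _].
rewrite /f /fbar cubic_cosine_coef polyseq_cubic_coef/= => -[a01 a0_gt0].
pose t := beta - 1.
have t_gt0 : 0 < t by rewrite subr_gt0.
have betaE : beta = 1 + t by rewrite /t addrC subrK.
pose b0 := alpha ^+ 2 + alpha + 1 / 2.
pose b1 := alpha ^+ 2 + 2 * alpha + 3 / 4.
pose c0 := alpha ^+ 2 + 1 / 2.
pose c1 := 2 * alpha.
have sq_alpha := sqr_ge0 alpha.
have c0_gt0 : 0 < c0 by rewrite /c0; lra.
have a0E : alpha ^+ 2 * beta + alpha + beta / 2 = b0 + t * c0.
  by rewrite betaE /b0 /c0; field.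
have a1E : alpha ^+ 2 + 2 * alpha * beta + 3 / 4 = b1 + t * c1.
  by rewrite betaE /b1 /c1; field.
rewrite a0E a1E in a01 a0_gt0.
(* By [a01], alpha + 1/4 + t (c1 - c0) > 0; if [c1 > c0], then already 2 alpha > c0 > 0. *)
have alpha_gt : - (1 / 4) < alpha.
  have [c01|c01] := leP c1 c0.
    have : t * c1 <= t * c0 by rewrite ler_wpM2l// ltW.
    by move: a01; rewrite /b0 /b1; lra.
  by move: c01; rewrite /c1 /c0; lra.
split; first by apply: C0_cubic1; rewrite alpha_gt.
have b0_gt0 : 0 < b0.
  by have := sqr_ge0 (alpha + 1 / 2); rewrite sqrrD /b0; lra.
have b01 : b0 < b1 by rewrite /b0 /b1; lra.
pose N := alpha ^+ 2 + 3 * alpha + 3 / 2.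
pose Ng := 2 * alpha + 1 / 2.
have N_gt0 : 0 < N.
  by have := sqr_ge0 (alpha + 1 / 2); rewrite sqrrD /N; lra.
have Ng_gt0 : 0 < Ng by rewrite /Ng; lra.
have tNg_gt0 : 0 < t * Ng by rewrite mulr_gt0.
rewrite !v_cubic a0E a1E.
have -> : alpha ^+ 2 * 1 + alpha + 1 / 2 = b0 by rewrite mulr1.
have -> : alpha ^+ 2 + 2 * alpha * 1 + 3 / 4 = b1 by rewrite mulr1.
have -> : alpha ^+ 2 + alpha + 1 + (2 * alpha + 1 / 2) * 1 = N.
  by rewrite /N; field.
have -> : alpha ^+ 2 + alpha + 1 + (2 * alpha + 1 / 2) * beta = N + t * Ng.
  by rewrite betaE /N /Ng; field.
have Wb_gt0 : 0 < Num.sqrt b1 - Num.sqrt b0 by rewrite subr_gt0 ltr_sqrt//; lra.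
have Wa_gt0 : 0 < Num.sqrt (b1 + t * c1) - Num.sqrt (b0 + t * c0).
  by rewrite subr_gt0 ltr_sqrt//; lra.
have [Wb2_gt0 Wa2_gt0] := (exprn_gt0 2 Wb_gt0, exprn_gt0 2 Wa_gt0).
rewrite ltr_pdivrMr// mulrAC ltr_pdivlMr//.
(* The goal is now cross-multiplied, free of division. *)
have [c01|c01] := leP c1 c0.
  have tc01 : t * c1 <= t * c0 by rewrite ler_wpM2l// ltW.
  have tc0 : 0 <= t * c0 by rewrite mulr_ge0// ltW.
  have W_le : Num.sqrt (b1 + t * c1) - Num.sqrt (b0 + t * c0) <=
      Num.sqrt b1 - Num.sqrt b0 by apply: sqrtB_le_of_gap; lra.
  apply: (@le_lt_trans _ _ (N * (Num.sqrt b1 - Num.sqrt b0) ^+ 2)).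
    by rewrite ler_pM2l// ler_pXn2r// nnegrE ltW.
  by rewrite ltr_pM2r//; lra.
have alpha_ge0 : 0 <= alpha by move: c01; rewrite /c1 /c0; lra.
have c1_ge0 : 0 <= c1 by rewrite /c1; lra.
have alpha01 : 0 <= alpha <= 1 by rewrite alpha_ge0.
have [b0_ge0 b1_ge0] : 0 <= b0 /\ 0 <= b1 by split; lra.
have t_ge0 := ltW t_gt0.
have sub := sqrtB_sqr_subadd _ _ _ _ _ b0_ge0 b1_ge0
  (mulr_ge0 t_ge0 (ltW c0_gt0)) (mulr_ge0 t_ge0 c1_ge0).
apply: (@le_lt_trans _ _ (N * ((Num.sqrt b1 - Num.sqrt b0) ^+ 2 +
  t * (Num.sqrt c1 - Num.sqrt c0) ^+ 2))).
  (* The squared gap is homogeneous of degree 1, so [t] factors out. *)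
  rewrite ler_pM2l// (le_trans sub)// lerD2l.
  by rewrite !sqrtrM// -mulrBr exprMn sqr_sqrtr.
(* The [fbar] terms cancel and [t] divides out, leaving the comparison of [g] with [fbar]. *)
rewrite mulrDr [ltRHS]mulrDl ltrD2l mulrCA -[ltRHS]mulrA ltr_pM2l//.
exact: v_quadratic_gt.
Qed.
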